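(* Let $m\ge1$ be an integer and $b$ a complex number. Define $g(n,m,0,b)$ by $\sum_{n\ge0}g(n,m,0,b)z^n=\frac{1}{\sqrt{1-4bz^m}}$ and let $dd_0^{(m)}(N,0,b)=\det\big(g(i+j,m,0,b)\big)_{i,j=0}^{N-1}$. Then $$dd_0^{(m)}(mn,0,b)=(-1)^{\binom{m-1}2n}2^{mn-1}b^{n(mn-1)}\quad(n\ge1),\qquad dd_0^{(m)}(mn+1,0,b)=(-1)^{\binom{m-1}2n}2^{mn}b^{n(mn+1)}\quad(n\ge0),$$ and $dd_0^{(m)}(N,0,b)=0$ for all $N\ge0$ not of the form $mn$ or $mn+1$.
   Context: The power series $\frac{1}{\sqrt{1-4bz^m}}$ is the formal power series with constant term $1$. *)

(* Defs.v *)
From mathcomp Require Import all_boot all_order all_algebra.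

Set Implicit Arguments.
Unset Strict Implicit.
Unset Printing Implicit Defensive.

Import Order.TTheory GRing.Theory Num.Theory.

Local Open Scope ring_scope.

(* A formal power series is given by its sequence of coefficients. *)
Definition fps (K : nzRingType) : Type := nat -> K.

Definition fps_mul (K : nzRingType) (f g : fps K) : fps K :=
  fun n => \sum_(i < n.+1) f i * g (n - i)%N.

Definition fps_of_poly (K : nzRingType) (p : {poly K}) : fps K :=
  fun n => p`_n.

(* [h = 1 / sqrt f]: [h] has constant term 1 and is the reciprocal of a square
   root of [f]; see [fps_invsqrt_exists] and [fps_invsqrt_uniq]. *)
Definition is_fps_invsqrt (K : nzRingType) (f h : fps K) : Prop :=
  h 0%N = 1 /\
  exists s : fps K, fps_mul s s =1 f /\ fps_mul h s =1 fps_of_poly 1.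

Definition hankel_det (K : comNzRingType) (a : fps K) (N : nat) : K :=
  \det (\matrix_(i < N, j < N) a (i + j)%N).

Lemma course_of_values (T : Type) (Phi : seq T -> T) :
  exists x : nat -> T, forall n, x n = Phi (mkseq x n).
Proof.
pose B n := iter n (fun s => rcons s (Phi s)) [::].
exists (fun n => Phi (B n)) => n; congr Phi.
rewrite /mkseq; elim: n => [//|n IHn].
by rewrite -[in RHS]addn1 iotaD map_cat /= cats1 add0n -IHn.
Qed.

Lemma fps_mul0E (K : nzRingType) (f g : fps K) :
  fps_mul f g 0%N = f 0%N * g 0%N.
Proof. by rewrite /fps_mul big_ord1 subnn. Qed.

Lemma fps_mulSE (K : nzRingType) (f g : fps K) n :
  fps_mul f g n.+1 =
  f 0%N * g n.+1 + \sum_(i < n) f i.+1 * g (n - i)%N + f n.+1 * g 0%N.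
Proof. by rewrite /fps_mul big_ord_recl big_ord_recr /= subnn subn0 addrA. Qed.

Lemma fps_one0 (K : nzRingType) : fps_of_poly (1 : {poly K}) 0%N = 1.
Proof. by rewrite /fps_of_poly coef1. Qed.

Lemma fps_oneS (K : nzRingType) n : fps_of_poly (1 : {poly K}) n.+1 = 0.
Proof. by rewrite /fps_of_poly coef1. Qed.

Lemma fps_invsqrt_exists (K : numFieldType) (f : fps K) :
  f 0%N = 1 -> exists h, is_fps_invsqrt f h.
Proof.
move=> f0.
have [s sE] := course_of_values (fun u : seq K =>
  if size u is n.+1 then
    (f n.+1 - \sum_(i < n) u`_i.+1 * u`_(n - i)) / 2%:R else 1).
have s0 : s 0%N = 1 by rewrite sE.
have [h hE] := course_of_values (fun u : seq K =>
  if size u is n.+1 then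
    - (u`_0 * s n.+1 + \sum_(i < n) u`_i.+1 * s (n - i)%N) else 1).
have h0 : h 0%N = 1 by rewrite hE.
exists h; split=> //; exists s; split=> -[|n].
- by rewrite fps_mul0E s0 mulr1 f0.
- rewrite fps_mulSE s0 mul1r mulr1 [s n.+1]sE size_mkseq.
  under eq_bigr => i _ do rewrite !nth_mkseq ?ltnS ?leq_subr //.
  set S := \sum_(i < n) _; set X := (_ / _).
  rewrite addrAC -mulr2n -mulr_natr /X divfK ?subrK //.
  by rewrite pnatr_eq0.
- by rewrite fps_mul0E s0 h0 mulr1 fps_one0.
rewrite fps_mulSE s0 mulr1 [h n.+1]hE size_mkseq fps_oneS nth_mkseq //.
under [X in - (_ + X)]eq_bigr => i _ do rewrite nth_mkseq ?ltnS //.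
by rewrite subrr.
Qed.

Lemma fps_invsqrt_uniq (K : numFieldType) (f h h' : fps K) :
  is_fps_invsqrt f h -> is_fps_invsqrt f h' -> h =1 h'.
Proof.
move=> [h0 [s [sf hs]]] [h'0 [s' [s'f h's']]].
have s0 : s 0%N = 1 by rewrite -[LHS]mul1r -h0 -fps_mul0E hs fps_one0.
have s'0 : s' 0%N = 1 by rewrite -[LHS]mul1r -h'0 -fps_mul0E h's' fps_one0.
have ss' : s =1 s'.
  elim/ltn_ind=> -[|n] IHn; first by rewrite s0 s'0.
  have := sf n.+1; rewrite -s'f !fps_mulSE s0 s'0 !mul1r !mulr1.
  under eq_bigr => i _ do rewrite !IHn ?ltnS ?leq_subr //.
  rewrite addrAC [RHS]addrAC => /addIr; rewrite -!mulr2n => /eqP.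
  by rewrite eqr_pMn2r // => /eqP.
elim/ltn_ind=> -[|n] IHn; first by rewrite h0 h'0.
have := hs n.+1; rewrite -h's' !fps_mulSE s0 s'0 !mulr1 h0 h'0 ss'.
under eq_bigr => i _ do rewrite ss' IHn ?ltnS //.
by move/addrI.
Qed.

(* Main.v *)
Require Import Defs.
From mathcomp Require Import all_boot all_order all_algebra complex reals.
From mathcomp Require Import zify ring.

Import GRing.Theory Num.Theory.
Local Open Scope ring_scope.

Set Implicit Arguments.
Unset Strict Implicit.

(** The coefficients are g(mq) = b^q binom(2q, q), and g vanishes off the
    multiples of m: this follows from the differential equation
    2 p g' + p' g = 0 for p = 1 - 4 b z^m.  Vandermonde's identity, folded
    around its centre, reads
      binom(2(i+j), i+j) =
        sum_k d_k binom(2i, i+k) binom(2j, j+k)  with d_0 = 1 and d_k = 2,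
      binom(2(i+j+1), i+j+1) =
        2 sum_k binom(2i+1, i+1+k) binom(2j+1, j+1+k).
    Applied within residue classes mod m, this factors the Hankel matrix as
    L D L^T with L lower unitriangular.  The row mt + r of D has a single
    nonzero entry, in column mt if r = 0 and in column mt + (m - r) otherwise.
    So D is made of diagonal blocks of alternating sizes 1 and m - 1, the
    latter antidiagonal, and a truncation inside an antidiagonal block, past
    its first row, leaves a zero row. *)

(** * Coefficients of the inverse square root *)

Section InverseSquareRoot.

Variable K : numFieldType.
Implicit Types p q : {poly K}.

Definition eq_mod_Xn (N : nat) p q := forall i, (i < N)%N -> p`_i = q`_i.

Lemma eq_mod_XnM N p p' q q' :
  eq_mod_Xn N p p' -> eq_mod_Xn N q q' -> eq_mod_Xn N (p * q) (p' * q').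
Proof.
move=> pp' qq' i iN; rewrite !coefM; apply: eq_bigr => j _.
have := ltn_ord j; rewrite ltnS => ji.
by rewrite pp' ?qq' //; [exact: leq_ltn_trans (leq_subr _ _) iN|
  exact: leq_ltn_trans ji iN].
Qed.

Lemma fps_mul_poly (f g : fps K) N :
  eq_mod_Xn N (\poly_(i < N) f i * \poly_(i < N) g i)
    (\poly_(i < N) fps_mul f g i).
Proof.
move=> i iN; rewrite coefM coef_poly iN; apply: eq_bigr => j _.
have := ltn_ord j; rewrite ltnS => ji.
by rewrite !coef_poly (leq_ltn_trans ji iN) (leq_ltn_trans (leq_subr _ _) iN).
Qed.

(* Differentiating h^2 p = 1 gives h (2 p h' + p' h) = 0, and h is
   invertible. *)
Lemma fps_invsqrt_ode p (h : fps K) : is_fps_invsqrt (fps_of_poly p) h ->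
  forall N, eq_mod_Xn N
    (2%:R *: ((\poly_(i < N.+1) h i)^`() * p) + \poly_(i < N.+1) h i * p^`()) 0.
Proof.
move=> [_ [s [ssp hs1]]] N; set H := \poly_(i < N.+1) h i.
set S := \poly_(i < N.+1) s i.
have SS : eq_mod_Xn N.+1 (S * S) p.
  by move=> i iN; rewrite fps_mul_poly // coef_poly iN ssp.
have HS : eq_mod_Xn N.+1 (H * S) 1.
  by move=> i iN; rewrite fps_mul_poly // coef_poly iN hs1.
have HHp : eq_mod_Xn N.+1 (H * H * p) 1.
  move=> i iN; rewrite -(eq_mod_XnM (p := H * H) (p' := H * H) _ SS) //.
  by rewrite mulrACA -[1]mulr1 (eq_mod_XnM HS HS).
have dHHp : eq_mod_Xn N (H * H * p)^`() 0.
  by move=> i iN; rewrite coef_deriv HHp // coef1 mul0rn coef0.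
set W := _ + _.
have dE : (H * H * p)^`() = H * W.
  by rewrite /W !derivM -mul_polyC polyCMn; ring.
move=> i iN.
have HS' : eq_mod_Xn N (H * S) 1 by move=> j jN; apply: HS; apply: ltnW.
have := eq_mod_XnM HS' (fun _ _ => erefl W`__) iN; rewrite mul1r => <-.
by have := eq_mod_XnM dHHp (fun _ _ => erefl S`__) iN; rewrite mul0r dE mulrAC.
Qed.

Lemma fps_invsqrt_rec (m : nat) (c : K) (h : fps K) : (0 < m)%N ->
  is_fps_invsqrt (fps_of_poly (1 - c *: 'X^m)) h ->
  forall n, 2%:R * n%:R * h n =
    if (n < m)%N then 0 else c * (2%:R * n%:R - m%:R) * h (n - m)%N.
Proof.
move=> m0 hh [|n]; first by rewrite m0 mulr0 mul0r.
have := @fps_invsqrt_ode _ _ hh n.+1 n (ltnSn _).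
set H := \poly_(i < _) _; rewrite coef0.
have Hc i : (i <= n.+1)%N -> H`_i = h i by move=> iN; rewrite coef_poly ltnS iN.
have d1 : (1 : {poly K})^`() = 0 by rewrite -polyC1 derivC.
rewrite derivB derivZ derivXn d1 sub0r mulrN.
rewrite mulrBr mulr1 -scaler_nat -!scalerAr !(coefD, coefN, coefZ).
have le_n k : (n - k <= n.+1)%N by apply: leqW; apply: leq_subr.
rewrite !coefMXn !coef_deriv !Hc ?ltnS ?leq_subr //.
case: m m0 {hh} => // m _; rewrite /= subSS !ltnS => E.
apply/eqP; rewrite -subr_eq0; apply/eqP; rewrite -[RHS]E {E}.
(* With [m] now replaced by [m.+1], the term of p h' in z^(m+1) starts at degree m + 1 and that of
   p' h at degree m, so n = m is a case of its own. *)
case: ltngtP => nm; rewrite -![h _ *+ _]mulr_natr; first by ring.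
  by rewrite subnSK // natrB 1?ltnW //; ring.
by rewrite nm subnn; ring.
Qed.

Lemma fps_invsqrt_coef (m : nat) (b : K) (h : fps K) : (0 < m)%N ->
  is_fps_invsqrt (fps_of_poly (1 - (4%:R * b) *: 'X^m)) h ->
  forall n, h n = if (m %| n)%N then b ^+ (n %/ m) * 'C((n %/ m).*2, n %/ m)%:R
                  else 0.
Proof.
move=> m0 hh; elim/ltn_ind => n IHn.
have [->|n0] := posnP n; first by rewrite dvdn0 div0n expr0 mul1r bin0; case: hh.
have /mulfI : 2%:R * n%:R != 0 :> K by rewrite -natrM pnatr_eq0 -lt0n muln_gt0.
apply; rewrite (fps_invsqrt_rec m0 hh); case: ltnP => [nm|mn].
  by rewrite gtnNdvd // mulr0.
rewrite IHn; last by rewrite ltn_subrL m0 n0.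
rewrite dvdn_subl //; case: ifP => [/dvdnP[q nE]|_]; last by rewrite !mulr0.
subst n; case: q mn {IHn} n0 => // q _ _.
rewrite mulSn addKn -mulSn !mulnK //.
(* The ratio 2(2q+1)/(q+1) of consecutive central binomials equals the recurrence factor
   4(2n-m)/(2n) at n = (q+1)m. *)
have E : (q.+1 * 'C(q.+1.*2, q.+1) = 2 * (q.*2.+1 * 'C(q.*2, q)))%N.
  rewrite doubleS -(mul_bin_diag q.*2.+2) (mul_bin_down q.*2.+1) /=.
  by rewrite (_ : q.*2.+1 - q = q.+1)%N ?mulnA ?mul2n ?doubleS //; lia.
transitivity (4%:R * m%:R * b ^+ q.+1 * (q.*2.+1 * 'C(q.*2, q))%:R :> K).
  by rewrite -muln2 !natrM exprS; ring.
transitivity (2%:R * m%:R * b ^+ q.+1 * (q.+1 * 'C(q.+1.*2, q.+1))%:R :> K).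
  by rewrite E !natrM; ring.
by rewrite !natrM; ring.
Qed.

End InverseSquareRoot.

(** * Folded Vandermonde identities *)

Lemma bin_Vandermonde_split (a c p q : nat) :
  ('C(a + c, p + q) = \sum_(k < p) 'C(a, p.-1 - k) * 'C(c, q.+1 + k) +
                      \sum_(k < q.+1) 'C(a, p + k) * 'C(c, q - k))%N.
Proof.
rewrite -binomial.Vandermonde -addnS big_split_ord /=; congr (_ + _)%N.
  (* Reversal indexes the lower half by its distance from the cut at [p]. *)
  rewrite (reindex_inj rev_ord_inj) /=; apply: eq_bigr => k _.
  by have := ltn_ord k => kp; congr ('C(_, _) * 'C(_, _))%N; lia.
by apply: eq_bigr => k _; rewrite subnDl.
Qed.

Lemma big_ord_widen_id (R : Type) (idx : R) (op : Monoid.law idx)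
    (F : nat -> R) p N : (p <= N)%N -> (forall k, (p <= k)%N -> F k = idx) ->
  \big[op/idx]_(k < p) F k = \big[op/idx]_(k < N) F k.
Proof.
move=> pN F0; rewrite -!(big_mkord xpredT F) [RHS](big_cat_nat _ (n := p)) //=.
have -> : \big[op/idx]_(p <= k < N) F k = idx; last by rewrite Monoid.mulm1.
by rewrite big_nat_cond big1 // => k /andP[/andP[/F0]].
Qed.

(** By the symmetry of binomials both halves of the split sum coincide, except that the centre k = 0
    occurs once. Terms with k > i or k > j vanish, which allows the common bound [N]. *)
Lemma central_bin_even (i j N : nat) : (i < N)%N -> (j < N)%N ->
  ('C((i + j).*2, i + j) = \sum_(k < N)
     (if k == 0 :> nat then 1 else 2) * ('C(i.*2, i + k) * 'C(j.*2, j + k)))%N.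
Proof.
case: N => // N; rewrite !ltnS => iN jN.
rewrite doubleD bin_Vandermonde_split !big_ord_recl /= !addn0 subn0 mul1n.
rewrite addnCA; congr (_ + _)%N.
rewrite -big_distrr /= mul2n -[RHS]addnn; congr (_ + _)%N.
  rewrite -(@big_ord_widen_id _ _ addn
    (fun k => 'C(i.*2, i + bump 0 k) * 'C(j.*2, j + bump 0 k))%N _ _ iN).
    apply: eq_bigr => k _; have := ltn_ord k => ki.
    rewrite -(bin_sub (m := i + bump 0 k)); last by rewrite /bump; lia.
    by congr ('C(_, _) * 'C(_, _))%N; rewrite /bump; lia.
  by move=> k ik; rewrite bin_small //; rewrite /bump; lia.
rewrite -(@big_ord_widen_id _ _ addn
  (fun k => 'C(i.*2, i + bump 0 k) * 'C(j.*2, j + bump 0 k))%N _ _ jN).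
  apply: eq_bigr => k _; have := ltn_ord k => ki.
  rewrite -(bin_sub (m := j + bump 0 k)); last by rewrite /bump; lia.
  by congr ('C(_, _) * 'C(_, _))%N; rewrite /bump; lia.
by move=> k ik; rewrite mulnC bin_small //; rewrite /bump; lia.
Qed.

(** For odd rows the centre of symmetry falls between two terms, so every term is doubled. *)
Lemma central_bin_odd (i j N : nat) : (i < N)%N -> (j < N)%N ->
  ('C((i + j).+1.*2, (i + j).+1) = \sum_(k < N)
     2 * ('C(i.*2.+1, i.+1 + k) * 'C(j.*2.+1, j.+1 + k)))%N.
Proof.
move=> iN jN; rewrite (_ : (i + j).+1.*2 = i.*2.+1 + j.*2.+1)%N; last by lia.
rewrite -addSn bin_Vandermonde_split -big_distrr /= mul2n -[RHS]addnn.
congr (_ + _)%N.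
  rewrite -(@big_ord_widen_id _ _ addn
    (fun k => 'C(i.*2.+1, i.+1 + k) * 'C(j.*2.+1, j.+1 + k))%N _ _ iN).
    apply: eq_bigr => k _; have := ltn_ord k => ki.
    rewrite -(bin_sub (m := i.+1 + k)); last by lia.
    by congr ('C(_, _) * 'C(_, _))%N; lia.
  by move=> k ik; rewrite bin_small //; lia.
rewrite -(@big_ord_widen_id _ _ addn
  (fun k => 'C(i.*2.+1, i.+1 + k) * 'C(j.*2.+1, j.+1 + k))%N _ _ jN).
  apply: eq_bigr => k _; have := ltn_ord k => ki.
  rewrite -(bin_sub (m := j.+1 + k)); last by lia.
  by congr ('C(_, _) * 'C(_, _))%N; lia.
by move=> k ik; rewrite mulnC bin_small //; lia.
Qed.

(** * Block and antidiagonal determinants *)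

Section Hankel.

Variable K : comNzRingType.

(** Entries come from a function on [nat], so one [F] serves all sizes and passing to a block is an
    index shift. *)
Definition nat_det (N : nat) (F : nat -> nat -> K) :=
  \det (\matrix_(i < N, j < N) F i j).

Lemma nat_det_block a c F :
  (forall i j, (i < c)%N -> (j < a)%N -> F (a + i)%N j = 0) ->
  nat_det (a + c) F = nat_det a F * nat_det c (fun i j => F (a + i)%N (a + j)%N).
Proof.
move=> F0; rewrite /nat_det -[X in \det X = _]submxK.
rewrite (_ : dlsubmx _ = 0) ?det_ublock; last first.
  by apply/matrixP=> i j; rewrite !mxE /= F0.
by congr (_ * _); congr (\det _); apply/matrixP=> i j; rewrite !mxE.
Qed.

Lemma nat_det1 F : nat_det 1 F = F 0%N 0%N.
Proof. by rewrite /nat_det det_mx11 mxE. Qed.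

Lemma eq_nat_det N F G : (forall i j, (i < N)%N -> (j < N)%N -> F i j = G i j) ->
  nat_det N F = nat_det N G.
Proof. by move=> FG; congr (\det _); apply/matrixP=> i j; rewrite !mxE FG. Qed.

Lemma nat_det_antidiag c (e : K) :
  nat_det c (fun i j => e * (i + j.+1 == c)%:R) = (-1) ^+ 'C(c, 2) * e ^+ c.
Proof.
elim: c => [|c IHc]; first by rewrite /nat_det det_mx00 !expr0 mulr1.
(* Only the last column survives in the first row; its sign (-1)^c supplies the increment from 'C(c,
   2) to 'C(c.+1, 2). *)
rewrite /nat_det (expand_det_row _ ord0) big_ord_recr /= big1 ?add0r.
  rewrite /cofactor mxE /= eqxx mulr1 add0n binS bin1 exprD exprS.
  set X := \det _; have -> : X = nat_det c (fun i j => e * (i + j.+1 == c)%:R).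
    congr (\det _); apply/matrixP=> i j; rewrite !mxE /= /bump /=.
    by rewrite [(c <= j)%N]leqNgt ltn_ord.
  by rewrite IHc; ring.
by move=> j _; rewrite mxE /= eqSS (ltn_eqF (ltn_ord j)) mulr0 mul0r.
Qed.

(** * Factorization of the Hankel matrix *)

Variables (m : nat) (b : K).
Hypothesis m_gt0 : (0 < m)%N.

(* [lfac], [dfac] are the factors L, D of the Hankel matrix. The difference
   [q - t] truncates only where the binomial coefficient is zero. *)
Definition lfac (i k : nat) : K :=
  let q := (i %/ m)%N in let t := (k %/ m)%N in
  if (i == k %[mod m])%N then
    (if (i %% m == 0)%N then 'C(q.*2, q + t) else 'C(q.*2.+1, q.+1 + t))%:R
      * b ^+ (q - t)
  else 0.

(** Pairs residues with sum divisible by [m], inside one block of [m] indices. *)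
Definition refl_mod (k : nat) : nat :=
  if (k %% m == 0)%N then k else (k %/ m * m + (m - k %% m))%N.

(** The factors 1 and 2 are the weights of the folded sums; the power of [b] is what remains of q +
    q' (or q + q' + 1) once L and its transpose take q - t and q' - t. *)
Definition dcoef (k : nat) : K :=
  let t := (k %/ m)%N in
  if (k %% m == 0)%N then (if t == 0%N then 1 else 2)%:R * b ^+ t.*2
  else 2%:R * b ^+ t.*2.+1.

Definition dfac (k l : nat) : K := dcoef k * (l == refl_mod k)%:R.

Lemma divmodMD q r : (r < m)%N ->
  (((q * m + r) %/ m)%N = q) * (((q * m + r) %% m)%N = r).
Proof.
by move=> rm; rewrite divnMDl // modnMDl divn_small // modn_small // addn0.
Qed.

(** Equal residues and i < k force a smaller quotient, which pushes the binomial out of range. *)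
Lemma lfac_triangular i k : (i < k)%N -> lfac i k = 0.
Proof.
move=> ik; rewrite /lfac; case: eqP => // rE.
have qt : (i %/ m < k %/ m)%N.
  rewrite ltnNge; apply/negP => kq; move: ik; rewrite ltnNge.
  by rewrite (divn_eq i m) (divn_eq k m) rE leq_add2r leq_mul2r kq orbT.
by case: ifP => _; rewrite bin_small ?mul0r //; lia.
Qed.

Lemma lfac_diag i : lfac i i = 1.
Proof.
rewrite /lfac eqxx subnn expr0 mulr1.
by case: ifP => _; rewrite ?addSn addnn binn.
Qed.

Lemma sum_lfac (F : nat -> K) q r N : (r < m)%N -> (q * m + r < N)%N ->
  \sum_(k < N) lfac (q * m + r) k * F k =
  \sum_(t < N) lfac (q * m + r) (t * m + r) * F (t * m + r)%N.
Proof.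
move=> rm iN.
(* Widening to [N * m] gives complete blocks, each meeting the residue class of [r] once; the added
   terms vanish by triangularity. *)
have NmN : (N <= N * m)%N by rewrite leq_pmulr.
rewrite (@big_ord_widen_id _ _ +%R
  (fun k => lfac (q * m + r) k * F k) _ _ NmN); last first.
  by move=> k Nk; rewrite lfac_triangular ?mul0r // (leq_trans iN).
rewrite -(big_mkord xpredT (fun k => lfac (q * m + r) k * F k)) big_nat_mul.
rewrite big_mkord; apply: eq_bigr => t _.
rewrite -{1}[(t * m)%N]add0n big_addn mulSn addnK big_mkord.
rewrite (bigD1 (Ordinal rm)) //= big1 ?addr0 => [|s sr].
  by rewrite [(r + _)%N]addnC.
have /negbTE rs : r != s :> nat by rewrite eq_sym.
by rewrite /lfac [(s + _)%N]addnC !divmodMD // rs mul0r.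
Qed.

Lemma sum_lfac_dcoef i j N : (i < N)%N -> (j < N)%N ->
  \sum_(k < N) lfac i k * (dcoef k * lfac j (refl_mod k)) =
  if (m %| i + j)%N then
    b ^+ ((i + j) %/ m) * 'C(((i + j) %/ m).*2, (i + j) %/ m)%:R
  else 0.
Proof.
rewrite (divn_eq i m) (divn_eq j m).
move: (i %/ m)%N (i %% m)%N (ltn_pmod i m_gt0) => q r rm.
move: (j %/ m)%N (j %% m)%N (ltn_pmod j m_gt0) => q' r' r'm iN jN.
have qN : (q < N)%N by apply: leq_ltn_trans iN; nia.
have q'N : (q' < N)%N by apply: leq_ltn_trans jN; nia.
rewrite (@sum_lfac (fun k => dcoef k * lfac _ (refl_mod k))) //.
rewrite addnACA -mulnDl /dvdn modnMDl divnMDl //.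
have [r0|r_gt0] := posnP r.
  subst r; rewrite add0n modn_small // divn_small // [(q + q' + 0)%N]addn0.
  rewrite /lfac /dcoef /refl_mod.
  under eq_bigr => t _ do rewrite !divmodMD // !eqxx.
  case: eqP => _; last by rewrite big1 // => t _; rewrite !mulr0.
  rewrite (central_bin_even qN q'N) natr_sum mulr_sumr /=.
  apply: eq_bigr => t _; rewrite !natrM.
  have [tq|qt] := leqP t q; last by rewrite bin_small ?mul0r ?mulr0 //; lia.
  have [tq'|qt'] := leqP t q'; last first.
    by rewrite (@bin_small q'.*2) ?mul0r ?mulr0 //; lia.
  rewrite (_ : q + q' = (q - t) + (q' - t) + t.*2)%N; last by lia.
  by rewrite !exprD; ring.
rewrite /lfac /dcoef /refl_mod.
have mr : (m - r < m)%N by lia.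
under eq_bigr => t _ do rewrite !divmodMD // !eqxx (gtn_eqF r_gt0) ?divmodMD //.
have [r'E|r'NE] := eqVneq r' (m - r)%N; last first.
  rewrite big1 => [|t _]; last by rewrite !mulr0.
  (* Here 0 < r + r' < 2m and r + r' differs from m. *)
  rewrite ifF //; apply/negbTE; rewrite -/(dvdn m _).
  apply/negP => /dvdnP[[|[|k]]]; lia.
have -> : (r' == 0%N) = false by lia.
have -> : (r + r' = m)%N by lia.
rewrite modnn divnn m_gt0 addn1 eqxx (central_bin_odd qN q'N).
rewrite natr_sum mulr_sumr; apply: eq_bigr => t _; rewrite !natrM.
have [tq|qt] := leqP t q; last by rewrite bin_small ?mul0r ?mulr0 //; lia.
have [tq'|qt'] := leqP t q'; last first.
  by rewrite (@bin_small q'.*2.+1) ?mul0r ?mulr0 //; lia.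
rewrite (_ : (q + q').+1 = (q - t) + (q' - t) + t.*2.+1)%N; last by lia.
by rewrite !exprD; ring.
Qed.

Lemma hankel_det_dfac (a : fps K) N :
  (forall n, a n = if (m %| n)%N then b ^+ (n %/ m) * 'C((n %/ m).*2, n %/ m)%N%:R
                   else 0) ->
  hankel_det a N = nat_det N dfac.
Proof.
move=> aE; pose L := \matrix_(i < N, j < N) lfac i j.
have detL : \det L = 1.
  rewrite det_trig; first by rewrite big1 // => i _; rewrite mxE lfac_diag.
  by apply/is_trig_mxP => i j ij; rewrite mxE lfac_triangular.
suff -> : hankel_det a N = \det (L *m ((\matrix_(i < N, j < N) dfac i j) *m L^T)).
  by rewrite !det_mulmx det_tr detL mul1r mulr1.
congr (\det _); apply/matrixP => i j; rewrite !mxE aE.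
rewrite -(@sum_lfac_dcoef i j N) //; apply: eq_bigr => k _; rewrite !mxE.
congr (_ * _); have [kN|Nk] := ltnP (refl_mod k) N.
  rewrite (bigD1 (Ordinal kN)) //= big1 ?addr0 => [|l lk].
    by rewrite !mxE /dfac eqxx mulr1.
  rewrite !mxE /dfac -[refl_mod k]/(val (Ordinal kN)) (inj_eq val_inj).
  by rewrite (negbTE lk) mulr0 mul0r.
(* The truncation cuts off the nonzero entry of row [k], but then [j < N <= refl_mod k] kills the
   other side as well. *)
rewrite lfac_triangular ?mulr0; last exact: leq_trans Nk.
rewrite big1 // => l _; rewrite !mxE /dfac ltn_eqF ?mulr0 ?mul0r //.
exact: leq_trans Nk.
Qed.

(** * Evaluation of det D *)

Lemma nat_det_dfac_mulS_rec n :
  nat_det (n * m).+1 dfac = nat_det (n * m) dfac * dcoef (n * m).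
Proof.
rewrite -addn1 nat_det_block ?nat_det1 => [|[|//] j _ jn];
  rewrite ?addn0 /dfac /refl_mod modnMl /= ?eqxx ?mulr1 //.
by rewrite ltn_eqF ?mulr0.
Qed.

(** For nonzero residues [dcoef] depends on the quotient only, so the antidiagonal block is
    constant. *)
Lemma nat_det_dfac_mul_rec n :
  nat_det (n.+1 * m) dfac =
  nat_det (n * m).+1 dfac *
    ((-1) ^+ 'C(m.-1, 2) * (2%:R * b ^+ n.*2.+1) ^+ m.-1).
Proof.
rewrite -nat_det_antidiag.
rewrite (_ : (n.+1 * m) = (n * m).+1 + m.-1)%N; last by lia.
have E i : (i < m.-1)%N -> ((n * m).+1 + i = n * m + i.+1)%N /\ (i.+1 < m)%N by lia.
rewrite nat_det_block => [|i j /E[-> im] jn]; last first.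
  by rewrite /dfac /refl_mod !divmodMD //= ltn_eqF ?mulr0 //; lia.
congr (_ * _); apply: eq_nat_det => i j /E[-> im] /E[-> jm].
rewrite /dfac /refl_mod /dcoef !divmodMD //=; congr (_ * (_ : bool)%:R).
by apply/eqP/eqP; lia.
Qed.

Lemma nat_det_dfac_mulS n : nat_det (n * m).+1 dfac =
  (-1) ^+ ('C(m.-1, 2) * n) * 2%:R ^+ (m * n) * b ^+ (n * (m * n).+1).
Proof.
elim: n => [|n IHn].
  by rewrite mul0n nat_det1 /dfac /dcoef /refl_mod div0n mod0n !muln0 !expr0
    !mulr1.
rewrite nat_det_dfac_mulS_rec nat_det_dfac_mul_rec IHn /dcoef modnMl mulnK //=.
rewrite [X in _ = X * _ * _]
  (_ : _ = (-1) ^+ ('C(m.-1, 2) * n) * (-1) ^+ 'C(m.-1, 2)).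
  (* One period adds m - 1 factors 2b^(2n+1) from the antidiagonal block and one factor 2b^(2n+2)
     from the next diagonal entry. *)
  rewrite (_ : (m * n.+1 = m * n + m.-1 + 1)%N); last by lia.
  rewrite (_ : (n.+1 * (m * n + m.-1 + 1).+1 =
    n * (m * n).+1 + n.*2.+1 * m.-1 + n.+1.*2)%N); last by nia.
  by rewrite exprMn -[(b ^+ _) ^+ _]exprM !exprD expr1; ring.
by rewrite -exprD mulnSr.
Qed.

Lemma nat_det_dfac_mul n : nat_det (n.+1 * m) dfac =
  (-1) ^+ ('C(m.-1, 2) * n.+1) * 2%:R ^+ (m * n.+1).-1 *
    b ^+ (n.+1 * (m * n.+1).-1).
Proof.
rewrite nat_det_dfac_mul_rec nat_det_dfac_mulS.
rewrite (_ : ((m * n.+1).-1 = m * n + m.-1)%N); last by lia.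
rewrite (_ : (n.+1 * (m * n + m.-1) = n * (m * n).+1 + n.*2.+1 * m.-1)%N);
  last by nia.
by rewrite [('C(_, _) * n.+1)%N]mulnSr exprMn -[(b ^+ _) ^+ _]exprM !exprD; ring.
Qed.

Lemma nat_det_dfac_eq0 n s : (1 < s < m)%N -> nat_det (n * m + s) dfac = 0.
Proof.
move=> /andP[s1 sm].
(* Row nm + 1 is supported in column nm + m - 1, which is cut off since s < m. *)
have rN : (n * m + 1 < n * m + s)%N by rewrite ltn_add2l.
rewrite /nat_det (expand_det_row _ (Ordinal rN)) big1 // => j _.
rewrite mxE /dfac /refl_mod !divmodMD ?(ltn_trans s1) //=.
by rewrite ltn_eqF ?mulr0 ?mul0r // (leq_trans (ltn_ord j)) // leq_add2l; lia.
Qed.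

End Hankel.

Theorem theorem5p5 (R : realType) (m : nat) (hm : (1 <= m)%N) (b : R[i])
    (g : fps R[i])
    (hg : is_fps_invsqrt (fps_of_poly (1 - (4%:R * b) *: 'X^m)) g) :
  [/\ (forall n : nat, (1 <= n)%N ->
         hankel_det g (m * n) =
           (-1) ^+ ('C(m - 1, 2) * n) * 2%:R ^+ (m * n - 1)
             * b ^+ (n * (m * n - 1))),
      (forall n : nat,
         hankel_det g (m * n + 1) =
           (-1) ^+ ('C(m - 1, 2) * n) * 2%:R ^+ (m * n)
             * b ^+ (n * (m * n + 1)))
    & (forall N : nat,
         ~ (exists n : nat, N = (m * n)%N \/ N = (m * n + 1)%N) ->
         hankel_det g N = 0)].
Proof.
have HE N := hankel_det_dfac hm N (fps_invsqrt_coef hm hg).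
split=> [[//|n] _|n|N Nmn].
- by rewrite HE mulnC nat_det_dfac_mul // !subn1 [(n.+1 * m)%N]mulnC.
- by rewrite HE !addn1 [(m * n)%N]mulnC nat_det_dfac_mulS // subn1 [(n * m)%N]mulnC.
(* Residues 0 and 1 of [N] mod [m] are exactly the excluded forms. *)
rewrite HE (divn_eq N m) nat_det_dfac_eq0 // ltn_pmod // andbT ltnNge.
apply/negP => r1; apply: Nmn; exists (N %/ m)%N.
have := divn_eq N m; case: (N %% m)%N r1 => [|[|//]] _ NE; [left|right].
- by rewrite {1}NE addn0 mulnC.
- by rewrite {1}NE mulnC.
Qed.
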